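(* Let $E_1,E_2$ be propositional variables and let $\varphi=(E_1\veebar E_2)\wedge\big(E_1\rightarrow\bigwedge_{0\le i<10}\neg K^iE_1\big)\wedge\big(E_2\rightarrow(\bigwedge_{0\le i<20}\neg K^iE_2\wedge\bigwedge_{10<i\le20}K^i\neg E_1)\big)$, where $\veebar$ is exclusive disjunction. Then $K^1\varphi\vdash_{\mathsf{tS4}}\bot$.
   Context: The timed modal epistemic language has formulas $A::= p\mid\bot\mid\neg A\mid A\wedge A\mid A\vee A\mid A\rightarrow A\mid K^iA$ for non-negative integers $i$. The logic $\mathsf{tK}$ has axioms: all propositional tautologies; tK: $K^i(A\rightarrow B)\rightarrow(K^jA\rightarrow K^kB)$ for $i,j<k$; Mon: $K^iA\rightarrow K^jA$ for $i<j$; and rules Modus Ponens, Deduction by Epistemization (from $\vdash A$ infer $\vdash K^iA\rightarrow K^jK^iA$, for $i<j$) and Epistemization (from $\vdash A$ infer $\vdash K^iA$). $\mathsf{tT}$ adds the axiom $K^iA\rightarrow A$, and $\mathsf{tS4}$ further adds $K^iA\rightarrow K^jK^iA$ for $i<j$. $\Gamma\vdash_{\mathsf{tS4}}B$ means $B$ is derivable from the premises $\Gamma$ and theorems of $\mathsf{tS4}$ by Modus Ponens (the two epistemization rules apply only to theorems), so that the deduction theorem holds. *)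

(* Defs.v *)
From mathcomp Require Import all_boot.

Set Implicit Arguments.
Unset Strict Implicit.
Unset Printing Implicit Defensive.

Inductive form : Type :=
  | Var of nat
  | Bot
  | Neg of form
  | And of form & form
  | Or of form & form
  | Imp of form & form
  | K of nat & form.

Declare Scope form_scope.
Delimit Scope form_scope with F.
Bind Scope form_scope with form.

Notation "A ∧ B" := (And A B) (at level 80, right associativity) : form_scope.
Notation "A ∨ B" := (Or A B) (at level 85, right associativity) : form_scope.
Notation "A → B" := (Imp A B) (at level 99, right associativity, B at level 200)
  : form_scope.
Notation "¬ A" := (Neg A) (at level 75, right associativity) : form_scope.
Notation "⊥" := Bot (at level 0) : form_scope.

Local Open Scope form_scope.

(* [v] is consulted on variables and on formulas [K i A] only, so that the
   latter behave as propositional atoms. *)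
Fixpoint bool_eval (v : form -> bool) (A : form) : bool :=
  match A with
  | Var _ => v A
  | ⊥ => false
  | ¬ B => ~~ bool_eval v B
  | B ∧ C => bool_eval v B && bool_eval v C
  | B ∨ C => bool_eval v B || bool_eval v C
  | B → C => bool_eval v B ==> bool_eval v C
  | K _ _ => v A
  end.

(* Tautologies of the full modal language, i.e. all substitution instances of
   classical propositional tautologies. *)
Definition tautology (A : form) : Prop :=
  forall v : form -> bool, bool_eval v A.

Inductive tK_thm (Ax : form -> Prop) : form -> Prop :=
  | thm_taut A : tautology A -> tK_thm Ax A
  | thm_tK i j k A B : i < k -> j < k ->
      tK_thm Ax (K i (A → B) → (K j A → K k B))
  | thm_Mon i j A : i < j -> tK_thm Ax (K i A → K j A)
  | thm_Ax A : Ax A -> tK_thm Ax A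
  | thm_MP A B : tK_thm Ax (A → B) -> tK_thm Ax A -> tK_thm Ax B
  | thm_DE i j A : i < j -> tK_thm Ax A -> tK_thm Ax (K i A → K j (K i A))
  | thm_E i A : tK_thm Ax A -> tK_thm Ax (K i A).

Inductive tT_axiom : form -> Prop :=
  | ax_T i A : tT_axiom (K i A → A).

Inductive tS4_axiom : form -> Prop :=
  | ax_tT A : tT_axiom A -> tS4_axiom A
  | ax_4 i j A : i < j -> tS4_axiom (K i A → K j (K i A)).

Definition tK : form -> Prop := tK_thm (fun _ => False).
Definition tT : form -> Prop := tK_thm tT_axiom.
Definition tS4 : form -> Prop := tK_thm tS4_axiom.

Inductive derives (L Gamma : form -> Prop) : form -> Prop :=
  | der_prem A : Gamma A -> derives L Gamma A
  | der_thm A : L A -> derives L Gamma A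
  | der_MP A B :
      derives L Gamma (A → B) -> derives L Gamma A -> derives L Gamma B.

Notation "Gamma ⊢[ L ] A" := (derives L Gamma A%F)
  (at level 100, L at level 200, no associativity).

Definition Xor (A B : form) : form := (A ∨ B) ∧ ¬ (A ∧ B).

Notation "A ⊻ B" := (Xor A B) (at level 85, right associativity) : form_scope.

(* No trailing unit on non-empty sequences: [:: A; B; C] is sent to A ∧ B ∧ C. *)
Fixpoint conj_seq (s : seq form) : form :=
  match s with
  | [::] => ¬ ⊥
  | [:: A] => A
  | A :: s' => A ∧ conj_seq s'
  end.

Notation "⋀_ ( m <= i < n ) A" := (conj_seq [seq A%F | i <- index_iota m n])
  (at level 75, m at level 50, i at level 50, n at level 50, A at level 75,
   format "⋀_ ( m  <=  i  <  n )  A") : form_scope.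

Definition surprise_exam (E1 E2 : form) : form :=
  (E1 ⊻ E2)
  ∧ (E1 → ⋀_(0 <= i < 10) ¬ K i E1)
  ∧ (E2 → (⋀_(0 <= i < 20) ¬ K i E2) ∧ (⋀_(10.+1 <= i < 20.+1) K i (¬ E1))).

(* Main.v *)
(** Write [H] for [K^1 φ].  If [H] and [E2] held, then [K^11 ¬E1]; but [H] also
    gives [K^2 (¬E1 → E2)], hence [K^12 E2], which [φ] excludes.  So [H → E1] is
    a theorem, and epistemizing it together with [H → K^2 H] gives
    [H → K^3 E1], again excluded by [φ]. *)
Require Import Defs.
From mathcomp Require Import all_boot.

Local Open Scope form_scope.

Lemma bool_eval_conj_seq v s :
  bool_eval v (conj_seq s) = all (bool_eval v) s.
Proof. by elim: s => //= A [_|B s <-] //=; rewrite andbT. Qed.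

Lemma bool_eval_bigconj v (F : nat -> form) m n i :
  m <= i < n -> bool_eval v (conj_seq [seq F j | j <- index_iota m n]) ->
  bool_eval v (F i).
Proof.
rewrite -mem_index_iota bool_eval_conj_seq all_map => i_mn /allP; exact.
Qed.

(** Moving the premises one by one into the conclusion as antecedents leaves a tautology, from which
    Modus Ponens recovers [A]. Hilbert-style derivations thus reduce to boolean reasoning with
    formulas [K i B] as atoms. *)
Lemma tK_thm_taut_consequence Ax (s : seq form) A :
  foldr (fun B P => tK_thm Ax B /\ P) True s ->
  (forall v, all (bool_eval v) s -> bool_eval v A) -> tK_thm Ax A.
Proof.
elim: s A => [|B s IHs] A /= => [_ sA | [thB ths] sA].
  by apply: thm_taut => v; apply: sA.
apply: thm_MP thB; apply: IHs => // v sv /=.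
by apply/implyP => Bv; apply: sA; rewrite Bv.
Qed.

(** Epistemizing the implication at the level [i] of its antecedent makes [i < k] the only
    constraint left by axiom tK. *)
Lemma K_lift Ax i k A B :
  i < k -> tK_thm Ax (A → B) -> tK_thm Ax (K i A → K k B).
Proof. by move=> ltik thAB; apply: thm_MP (thm_E i thAB); apply: thm_tK. Qed.

Lemma surprise_exam_E1 A B :
  tS4 (K 1 (surprise_exam A B) → A).
Proof.
have thT : tS4 (K 1 (surprise_exam A B) → surprise_exam A B).
  by apply: thm_Ax; apply: ax_tT; apply: ax_T.
have thK2 : tS4 (K 1 (surprise_exam A B) → K 2 (¬ A → B)).
  apply: K_lift => //; apply: thm_taut => v /=.
  by case: (bool_eval v A); case: (bool_eval v B); rewrite ?implybT.
(* Level 11 is the first at which [B] yields knowledge of [¬ A]; 12 is the least level above both 2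
   and 11, and is still below 20. *)
have thK12 : tS4 (K 2 (¬ A → B) → K 11 (¬ A) → K 12 B) by apply: thm_tK.
apply: (@tK_thm_taut_consequence _ [:: _; _; _] _
  (conj thT (conj thK2 (conj thK12 I)))) => v.
case/and4P => /implyP Tv /implyP K2v /implyP K12v _; apply/implyP => Hv.
have /and3P[/andP[/orP[//|Bv] _] _ /implyP/(_ Bv)/andP[nKBv KnAv]] := Tv Hv.
have K11v := @bool_eval_bigconj v (fun i => K i (¬ A)) 11 21 11 isT KnAv.
have nK12v := @bool_eval_bigconj v (fun i => ¬ K i B) 0 20 12 isT nKBv.
by case/negP: nK12v; apply: (implyP (K12v (K2v Hv))).
Qed.

Lemma surprise_exam_inconsistent A B :
  tS4 (K 1 (surprise_exam A B) → ⊥).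
Proof.
set H := K 1 (surprise_exam A B).
have thT : tS4 (H → surprise_exam A B).
  by apply: thm_Ax; apply: ax_tT; apply: ax_T.
have thA : tS4 (H → A) := surprise_exam_E1 A B.
(* This needs the tS4 axiom: Deduction by Epistemization would require [surprise_exam A B] to be a
   theorem. *)
have th4 : tS4 (H → K 2 H) by apply: thm_Ax; apply: ax_4.
(* The implication lifted is [thA]; level 3 lies below the bound 10 on ignorance of [A]. *)
have thK3 : tS4 (K 2 H → K 3 A) by apply: K_lift.
apply: (@tK_thm_taut_consequence _ [:: _; _; _; _] _
  (conj thT (conj thA (conj th4 (conj thK3 I))))) => v.
case/and5P => /implyP Tv /implyP Av /implyP v4 /implyP K3v _.
apply/implyP => Hv.
have /and3P[_ /implyP/(_ (Av Hv)) nKAv _] := Tv Hv.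
have nK3v := @bool_eval_bigconj v (fun i => ¬ K i A) 0 10 3 isT nKAv.
by case/negP: nK3v; apply: K3v (v4 Hv).
Qed.

Theorem theorem35 (e1 e2 : nat) :
  (fun A => A = K 1 (surprise_exam (Var e1) (Var e2))) ⊢[ tS4 ] Bot.
Proof.
apply: der_MP (der_thm _ (surprise_exam_inconsistent _ _)) _.
exact: der_prem.
Qed.
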